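(* Let $f=g\circ F+h$ satisfy Assumption A, let $M-L_g\|L_p\|>0$, let $(x_k)_{k\ge 0}$ be generated by the RHOTA algorithm, and let $\mu>M+L_g\|L_p\|$. Assume that for some $\delta\ge 0$ and every $k\ge 0$ $$s_M(x_{k+1};x_k)-\min_{y:\ \|y-x_k\|\le D_k}s_M(y;x_k)\le\frac{\delta}{(p+1)!}\|x_{k+1}-x_k\|^{p+1},\qquad D_k:=\left(\tfrac{(p+1)!}{\mu}(f(x_k)-f^* )\right)^{\frac1{p+1}}.$$ Assume moreover that $(x_k)_{k\ge 0}$ is bounded, that $f$ is continuous, and that $f$ satisfies the KL property with exponent $q$ on the set $\Omega(x_0)$ of limit points of $(x_k)_{k\ge 0}$. Let $f_*$ denote the (constant) value of $f$ on $\Omega(x_0)$. Then, for $k$ sufficiently large: 1. If $q\ge\frac{p+1}{p}$, then $f(x_k)$ converges to $f_*$ linearly. 2. If $q<\frac{p+1}{p}$, then $f(x_k)$ converges to $f_*$ at a sublinear rate of order $\mathcal{O}\left(\frac{1}{k^{\frac{pq}{p+1-pq}}}\right)$.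
   Context: Problem: $\min_{x\in\mathbb{R}^n} f(x):=g(F(x))+h(x)$, where $F=(F_1,\dots,F_m):\mathbb{R}^n\to\mathbb{R}^m$, and $p\ge 1$ is an integer. Assumption A: (1) each $F_i:\mathbb{R}^n\to\mathbb{R}$ is $p$ times differentiable with $p$th derivative Lipschitz continuous with constant $L_p^i$, i.e. $\|D^pF_i(x)-D^pF_i(y)\|\le L_p^i\|x-y\|$ for all $x,y$; (2) $g:\mathbb{R}^m\to\mathbb{R}$ is convex and Lipschitz continuous with constant $L_g$, and $h:\mathbb{R}^n\to\mathbb{R}\cup\{+\infty\}$ is proper, lower semicontinuous and convex; (3) the problem has a solution, and $f^*$ is a real number with $\inf_{x\in\mathrm{dom} f}f(x)\ge f^*$. Notation: $L_p=(L_p^1,\dots,L_p^m)$, $\|\cdot\|$ is the Euclidean norm; $T_p^{F_i}(y;x)=F_i(x)+\sum_{j=1}^p\frac1{j!}D^jF_i(x)[y-x]^j$, $T_p^F=(T_p^{F_1},\dots,T_p^{F_m})$. For $M>0$, $$s_M(y;x):=g\left(T_p^F(y;x)\right)+\frac{M}{(p+1)!}\|y-x\|^{p+1}+h(y).$$ RHOTA algorithm: given $x_0\in\mathrm{dom} f$ and $M>0$, for each $k\ge 0$ take any $x_{k+1}\in\mathrm{dom} f$ with $s_M(x_{k+1};x_k)\le s_M(x_k;x_k)$. $\Omega(x_0)$ is the set of all limits of convergent subsequences of $(x_k)_{k\ge 0}$; under the hypotheses, $f$ is constant on it. $S_f(x):=\mathrm{dist}(0,\partial f(x))$, where $\partial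 f$ is the limiting (Mordukhovich) subdifferential. KL property of $f$ on $\Omega$ with exponent $q$, where $f$ takes the constant value $f_*$ on $\Omega$: there are constants $\sigma_q>0$, $q>0$, $\bar\delta>0$, $\bar\epsilon>0$ such that $$f(x)-f_*\le\sigma_q\,S_f(x)^q\quad\text{for all }x\text{ with }\mathrm{dist}(x,\Omega)\le\bar\delta,\ f_*<f(x)<f_*+\bar\epsilon.$$ *)

(* Defs.v *)
From HB Require Import structures.
From mathcomp Require Import all_boot all_order all_algebra.
From mathcomp Require Import all_classical all_reals all_analysis.

Set Implicit Arguments.
Unset Strict Implicit.
Unset Printing Implicit Defensive.

Import Order.TTheory GRing.Theory Num.Theory.
Import numFieldNormedType.Exports.

Local Open Scope classical_set_scope.
Local Open Scope ring_scope.

(* The library norm `|x| on 'rV[R]_n is the sup norm, so the Euclidean norm is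
   introduced separately. The topology and Frechet differentiability do not
   depend on this choice. *)
Definition edot (R : realType) (n : nat) (u v : 'rV[R]_n) : R :=
  \sum_(i < n) u ord0 i * v ord0 i.

Definition enorm (R : realType) (n : nat) (u : 'rV[R]_n) : R :=
  Num.sqrt (edot u u).

(* Equal to +oo when A is empty. *)
Definition euclid_dist (R : realType) (n : nat) (x : 'rV[R]_n)
  (A : set 'rV[R]_n) : \bar R := ereal_inf [set (enorm (x - z))%:E | z in A].

(* Dform phi [:: v_1; ...; v_j] x is D^j phi(x)[v_1, ..., v_j], the j-th
   differential of phi at x as a multilinear form: D^j phi(x)[v_1, ..., v_j] is
   the Frechet differential at x, applied to v_1, of the map
   z |-> D^(j-1) phi(z)[v_2, ..., v_j]. *)
Fixpoint Dform (R : realType) (n : nat) (phi : 'rV[R]_n -> R)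
    (vs : seq 'rV[R]_n) : 'rV[R]_n -> R :=
  if vs is v :: ws then fun x => ('d (Dform phi ws) x : 'rV[R]_n -> R) v
  else phi.

(* In finite dimension, differentiability of z |-> D^j phi(z) as a map into
   j-linear forms is differentiability of all its evaluations. *)
Definition times_differentiable (R : realType) (n p : nat)
    (phi : 'rV[R]_n -> R) : Prop :=
  forall vs : seq 'rV[R]_n, (size vs < p)%N ->
  forall x : 'rV[R]_n, differentiable (Dform phi vs) x.

(* || D^p phi(x) - D^p phi(y) ||, the operator norm of a p-linear form. *)
Definition Dform_dist (R : realType) (n p : nat) (phi : 'rV[R]_n -> R)
    (x y : 'rV[R]_n) : \bar R :=
  ereal_sup [set `|Dform phi vs x - Dform phi vs y|%:E
    | vs in [set vs : seq 'rV[R]_n |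
               size vs = p /\ forall v, v \in vs -> enorm v <= 1]].

Definition Dform_lipschitz (R : realType) (n p : nat) (phi : 'rV[R]_n -> R)
    (L : R) : Prop :=
  forall x y : 'rV[R]_n, (Dform_dist p phi x y <= (L * enorm (x - y))%R%:E)%E.

Definition elipschitz (R : realType) (m : nat) (g : 'rV[R]_m -> R) (L : R) :
  Prop := forall u v : 'rV[R]_m, `|g u - g v| <= L * enorm (u - v).

(* h takes its values in R u {+oo} and is not identically +oo. *)
Definition proper_efun (R : realType) (n : nat) (h : 'rV[R]_n -> \bar R) :
  Prop := (forall x, h x != -oo%E) /\ (exists x, (h x < +oo)%E).

(* The endpoints t = 0, 1 are harmless since 0 * +oo = 0 in \bar R. *)
Definition econvex (R : realType) (n : nat) (h : 'rV[R]_n -> \bar R) : Prop :=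
  forall (x y : 'rV[R]_n) (t : R), 0 <= t <= 1 ->
  (h (t *: x + (1 - t) *: y)%R <= t%:E * h x + (1 - t)%R%:E * h y)%E.

Definition edom (R : realType) (n : nat) (f : 'rV[R]_n -> \bar R) :
  set 'rV[R]_n := [set x | (f x < +oo)%E].

Definition component (R : realType) (n m : nat) (F : 'rV[R]_n -> 'rV[R]_m)
  (i : 'I_m) : 'rV[R]_n -> R := fun x => F x ord0 i.

Definition composite_objective (R : realType) (n m : nat)
    (F : 'rV[R]_n -> 'rV[R]_m) (g : 'rV[R]_m -> R) (h : 'rV[R]_n -> \bar R) :
    'rV[R]_n -> \bar R :=
  fun x => ((g (F x))%:E + h x)%E.

Definition taylor_poly (R : realType) (n p : nat) (phi : 'rV[R]_n -> R)
    (y x : 'rV[R]_n) : R :=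
  phi x + \sum_(1 <= j < p.+1) (j`!%:R)^-1 * Dform phi (nseq j (y - x)) x.

Definition taylor_map (R : realType) (n m p : nat)
    (F : 'rV[R]_n -> 'rV[R]_m) (y x : 'rV[R]_n) : 'rV[R]_m :=
  \row_(i < m) taylor_poly p (component F i) y x.

(* tensor_model p F g h M y x is s_M(y; x). *)
Definition tensor_model (R : realType) (n m p : nat) (F : 'rV[R]_n -> 'rV[R]_m)
    (g : 'rV[R]_m -> R) (h : 'rV[R]_n -> \bar R) (M : R)
    (y x : 'rV[R]_n) : \bar R :=
  ((g (taylor_map p F y x))%:E
   + (M / (p.+1)`!%:R * enorm (y - x) ^+ p.+1)%R%:E + h y)%E.

Definition RHOTA (R : realType) (n m p : nat) (F : 'rV[R]_n -> 'rV[R]_m)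
    (g : 'rV[R]_m -> R) (h : 'rV[R]_n -> \bar R) (M : R)
    (x : nat -> 'rV[R]_n) : Prop :=
  [/\ 0 < M, edom (composite_objective F g h) (x 0%N)
    & forall k, edom (composite_objective F g h) (x k.+1) /\
        (tensor_model p F g h M (x k.+1) (x k)
           <= tensor_model p F g h M (x k) (x k))%E].

(* D_k at the point x = x_k; mu and flow play the roles of mu and f^*. *)
Definition search_radius (R : realType) (n p : nat) (f : 'rV[R]_n -> \bar R)
    (mu flow : R) (x : 'rV[R]_n) : R :=
  ((p.+1)`!%:R / mu * (fine (f x) - flow)) `^ ((p.+1)%:R^-1).

(* The minimum over the compact ball is the infimum, attained because s_M(.; x)
   is lower semicontinuous. *)
Definition tensor_model_min (R : realType) (n m p : nat)
    (F : 'rV[R]_n -> 'rV[R]_m) (g : 'rV[R]_m -> R) (h : 'rV[R]_n -> \bar R)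
    (M r : R) (x : 'rV[R]_n) : \bar R :=
  ereal_inf [set tensor_model p F g h M y x
    | y in [set y | enorm (y - x) <= r]].

Definition limit_points (R : realType) (n : nat) (x : nat -> 'rV[R]_n) :
  set 'rV[R]_n :=
  [set z | exists2 s : nat -> nat, increasing_seq s & (x \o s) @ \oo --> z].

Definition frechet_subdiff (R : realType) (n : nat) (f : 'rV[R]_n -> \bar R)
    (x : 'rV[R]_n) : set 'rV[R]_n :=
  [set v | edom f x /\
    (0 <= limf_einf (fun y : 'rV[R]_n =>
       (f y - f x - (edot v (y - x))%R%:E)
         * ((enorm (y - x))^-1)%R%:E) (x^'))%E].

Definition limiting_subdiff (R : realType) (n : nat) (f : 'rV[R]_n -> \bar R)
    (x : 'rV[R]_n) : set 'rV[R]_n :=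
  [set v | edom f x /\
    exists u w : nat -> 'rV[R]_n,
      [/\ u @ \oo --> x, (f \o u) @ \oo --> f x,
          forall k, frechet_subdiff f (u k) (w k) & w @ \oo --> v]].

(* S_f(x) = dist(0, \partial f(x)), equal to +oo when the subdifferential is
   empty. *)
Definition subdiff_slope (R : realType) (n : nat) (f : 'rV[R]_n -> \bar R)
    (x : 'rV[R]_n) : \bar R := euclid_dist 0 (limiting_subdiff f x).

(* fval is the value of f on Omega. *)
Definition KL_property (R : realType) (n : nat) (f : 'rV[R]_n -> \bar R)
    (Omega : set 'rV[R]_n) (fval q : R) : Prop :=
  0 < q /\
  exists sigma dbar ebar : R,
    [/\ 0 < sigma, 0 < dbar, 0 < ebar
      & forall x : 'rV[R]_n, (euclid_dist x Omega <= dbar%:E)%E ->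
          (fval%:E < f x)%E -> (f x < (fval + ebar)%R%:E)%E ->
          (f x - fval%:E <= sigma%:E * poweR (subdiff_slope f x) q)%E].

Definition linear_rate (R : realType) (a : nat -> R) (l : R) : Prop :=
  exists c : R, [/\ 0 < c, c < 1
    & \forall k \near \oo, `|a k.+1 - l| <= c * `|a k - l|].

(* Main.v *)
(* Let y_k minimise f + mu / (p+1)! |. - x_k|^(p+1). Comparing y_k with x_k puts
   it in the ball of radius D_k, so the inexactness condition and the Taylor
   bound |g(F y) - g(T(y; x))| <= Lg |Lp| / (p+1)! |y - x|^(p+1) control both
   |y_k - x_k|^(p+1) and f(x_{k+1}) - f(y_k) by |x_{k+1} - x_k|^(p+1), hence by
   d_k = f(x_k) - f(x_{k+1}). Optimality of y_k gives
   S_f(y_k) <= mu / p! |y_k - x_k|^p, and the KL inequality at y_k yields, with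
   a_k = f(x_k) - f_* and t = p q / (p+1),
     a_{k+1} <= A d_k^t + B d_k
   for large k. Both rates follow from this recursion. *)

Require Import Defs.
From HB Require Import structures.
From mathcomp Require Import all_boot all_order all_algebra.
From mathcomp Require Import ring lra.
From mathcomp Require Import all_classical all_reals all_analysis.

Set Implicit Arguments.
Unset Strict Implicit.
Unset Printing Implicit Defensive.

Import Order.TTheory GRing.Theory Num.Theory.
Import numFieldNormedType.Exports.

Local Open Scope classical_set_scope.
Local Open Scope ring_scope.

(** The iterates satisfy only conditions on function values, so nothing makes a subgradient of f at
    x_{k+1} small and KL gives no usable bound there. It is applied at y_k, whose exact optimality
    supplies a subgradient; the inexactness condition then carries the bound on f(y_k) back to
    f(x_{k+1}). The two strict inequalities on the constants act separately: M > Lg |Lp| makes d_k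
    dominate |x_{k+1} - x_k|^(p+1), while mu > M + Lg |Lp| lets the term in |y_k - x_k|^(p+1) be
    absorbed when the optimality and inexactness inequalities are added. KL is local, but d_k -> 0
    forces y_k - x_k -> 0, and a bounded sequence approaches its limit points. In the recursion d_k
    <= 1 eventually, so the smaller of the exponents t and 1 decides the rate; t >= 1 means exactly
    q >= (p+1)/p. *)

(** * Real sequences: decay rates from a recursive inequality *)

Lemma expr1D_le (R : realFieldType) (t : R) (N : nat) :
  0 <= t -> t <= 1 -> (1 + t) ^+ N <= 1 + 2 ^+ N * t.
Proof.
(* The slope of the chord over [0, 1] is [2 ^+ N - 1]; the induction closes with this sharper
   constant but not with [2 ^+ N]. *)
move=> t0 t1; suff: (1 + t) ^+ N <= 1 + (2 ^+ N - 1) * t by lra.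
elim: N => [|N IH]; first by rewrite !expr0; lra.
have u1 : 0 <= (2 : R) ^+ N - 1 by rewrite subr_ge0 exprn_ege1// ler1n.
have u2 := mulr_ge0 u1 t0.
rewrite exprSr [2 ^+ N.+1]exprSr.
apply: (le_trans (ler_wpM2r _ IH)); first by lra.
nra.
Qed.

(** Rounding b up to an integer N gives (1 + 1/k)^b <= (1 + 1/k)^N <= 1 + 2^N / k, and k + 1 <= 2 k
    turns 1/k into 2/(k+1). *)
Lemma powR_succ_ratio (R : realType) (b : R) : 0 <= b ->
  exists2 B : R, 0 < B & forall k : nat, (0 < k)%N ->
    k.+1%:R `^ b / k%:R `^ b <= 1 + B / k.+1%:R.
Proof.
move=> b0; set N := Num.bound b.
have bN : b <= N%:R by rewrite ltW// archi_boundP.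
exists (2 ^+ N * 2); first by rewrite mulr_gt0// exprn_gt0.
move=> k k0; have k0R : (0 : R) < k%:R by rewrite ltr0n.
have k1R : (1 : R) <= k%:R by rewrite ler1n.
have kS : (k.+1%:R : R) = k%:R + 1 by rewrite -natr1.
rewrite -powRN -powR_inv1; last exact: ler0n.
rewrite [X in _ * X <= _](_ : _ = (k%:R^-1) `^ b); last first.
  by rewrite -[in RHS]powR_inv1 ?ler0n// -powRrM mulN1r.
rewrite powR_inv1 ?ler0n// -powRM ?ler0n ?invr_ge0 ?ler0n//.
have -> : k.+1%:R / k%:R = 1 + k%:R^-1 :> R.
  by rewrite kS mulrDl mul1r divff// gt_eqF.
have i0 : 0 < (k%:R : R)^-1 by rewrite invr_gt0.
have i1 : (k%:R : R)^-1 <= 1 by rewrite invf_le1.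
apply: (@le_trans _ _ ((1 + k%:R^-1) `^ N%:R)).
  by apply: ler_powR => //; lra.
rewrite powR_mulrn; last by lra.
apply: (le_trans (expr1D_le _ (ltW i0) i1)).
rewrite lerD2l -mulrA ler_wpM2l ?exprn_ge0//.
by rewrite ler_pdivlMr ?ltr0Sn// kS mulrC mulrDl mul1r divff ?gt_eqF//; lra.
Qed.

(* If [a k <= A / k `^ b] fails for the first time at [k + 1], then
   [(a k.+1 / C) `^ t^-1 <= a k - a k.+1] forces [(A / C) `^ t^-1 < B * A];
   [A] is chosen to exclude this. *)
Lemma sublinear_decay (R : realType) (a : nat -> R) (C t : R) (K : nat) :
  0 < C -> 0 < t -> t < 1 ->
  (forall k, (K <= k)%N ->
     [/\ 0 <= a k, a k.+1 <= a k & a k.+1 <= C * (a k - a k.+1) `^ t]) ->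
  exists A : R, forall k, (0 < k)%N -> (K <= k)%N ->
    a k <= A / k%:R `^ (t / (1 - t)).
Proof.
move=> C0 t0 t1 aK; set b := t / (1 - t).
have b0 : 0 < b by rewrite divr_gt0// subr_gt0.
have [B B0 HB] := powR_succ_ratio (ltW b0).
set K1 := maxn 1 K; set s := t^-1.
have s0 : 0 < s by rewrite invr_gt0.
have bs : b * s = b + 1.
  by rewrite /b /s; field; rewrite (gt_eqF t0) subr_eq0 (gt_eqF t1).
have K1K : (K <= K1)%N by rewrite leq_maxr.
(* Since b (s - 1) = 1, [A0] is the solution of (A / C)^s = B A. The term added to it in [A] settles
   the base case k = [K1]. *)
set A0 := (B * C `^ s) `^ b.
have A00 : 0 < A0 by rewrite powR_gt0// mulr_gt0// powR_gt0.
set A := A0 + a K1 * K1%:R `^ b.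
have aK10 : 0 <= a K1 by have [] := aK _ K1K.
have AA0 : A0 <= A by rewrite lerDl mulr_ge0// powR_ge0.
have A0' : 0 < A by exact: lt_le_trans AA0.
have hA : B * A <= (A / C) `^ s.
  have -> : (A / C) `^ s = A `^ (s - 1) * A / C `^ s.
    rewrite powRM ?invr_ge0 ?ltW// -(powR_inv1 (ltW C0)) powRAC powR_inv1 ?powR_ge0//.
    congr (_ / _); rewrite -[X in _ = _ * X](powRr1 (ltW A0')).
    by rewrite -powRD ?subrK// (gt_eqF A0') implybT.
  rewrite ler_pdivlMr ?powR_gt0// mulrAC ler_wpM2r ?(ltW A0')//.
  have sb : b * (s - 1) = 1 by rewrite mulrBr bs mulr1 addrAC subrr add0r.
  have -> : B * C `^ s = A0 `^ (s - 1).
    by rewrite /A0 -powRrM sb powRr1// mulr_ge0 ?powR_ge0// ltW.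
  have s1 : 0 <= s - 1.
    by rewrite -(pmulr_rge0 _ b0) sb.
  by apply: ge0_ler_powR => //; rewrite nnegrE ltW.
exists A => k k0 Kk.
have K1k : (K1 <= k)%N by rewrite geq_max k0.
rewrite -(subnK K1k); elim: (k - K1)%N => [|j IH].
  rewrite add0n ler_pdivlMr ?powR_gt0 ?ltr0n ?leq_max//.
  by rewrite lerDr ltW.
rewrite addSn; move: IH; set i := (j + K1)%N => IH.
have Ki : (K <= i)%N by rewrite (leq_trans K1K)// leq_addl.
have i0 : (0 < i)%N by rewrite (@leq_trans K1)// ?leq_addl// leq_maxl.
have i0R : (0 : R) < i%:R by rewrite ltr0n.
have [ai0 aiS aiC] := aK _ Ki.
have [aiS0 _ _] := aK _ (leqW Ki).
rewrite leNgt; apply/negP => abs.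
set S := i.+1%:R `^ b in abs.
have S0 : 0 < S by rewrite powR_gt0// ltr0Sn.
have T0 : (0 : R) < i%:R `^ b by rewrite powR_gt0.
have h1 : (a i.+1 / C) `^ s <= a i - a i.+1.
  rewrite -[leRHS]powRr1 ?subr_ge0// -(@mulfV _ t) ?gt_eqF// powRrM.
  by apply: ge0_ler_powR; rewrite ?nnegrE ?powR_ge0 ?divr_ge0 ?(ltW s0) ?(ltW C0)//
    ler_pdivrMr// mulrC.
have h2 : (A / S / C) `^ s <= (a i.+1 / C) `^ s.
  by apply: ge0_ler_powR; rewrite ?nnegrE ?divr_ge0 ?(ltW s0) ?(ltW C0)
    ?(ltW A0') ?(ltW S0)// ler_pM2r ?invr_gt0// ltW.
have h3 : (A / S / C) `^ s = (A / C) `^ s / (S * i.+1%:R).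
  have AC0 : 0 <= A / C by rewrite divr_ge0 ?ltW.
  rewrite mulrAC [LHS]powRM ?invr_ge0 ?(ltW S0)//.
  congr (_ * _); rewrite -(powR_inv1 (ltW S0)) powRAC powR_inv1 ?powR_ge0//.
  congr (_^-1); rewrite /S -powRrM bs powRD ?powRr1//.
  by rewrite pnatr_eq0/= implybT.
have h4 : a i - a i.+1 < A / i%:R `^ b - A / S by lra.
have h5 : A / i%:R `^ b - A / S <= B * A / (S * i.+1%:R).
  have -> : A / i%:R `^ b - A / S = A / S * (S / i%:R `^ b - 1).
    by field; rewrite !gt_eqF.
  rewrite (_ : B * A / (S * i.+1%:R) = A / S * (B / i.+1%:R)); last first.
    by field; rewrite (gt_eqF S0) nat1r pnatr_eq0.
  rewrite ler_wpM2l ?divr_ge0 ?(ltW A0') ?(ltW S0)//.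
  by rewrite lerBlDl HB.
have : (A / C) `^ s / (S * i.+1%:R) < B * A / (S * i.+1%:R).
  by rewrite -h3 (le_lt_trans h2)// (le_lt_trans h1)// (lt_le_trans h4).
by rewrite ltr_pM2r ?invr_gt0 ?mulr_gt0 ?ltr0Sn// ltNge hA.
Qed.

(** Once the decrement d lies in [0, 1], both d^t and d are at most d^s for every s <= min(t, 1), so
    the two terms merge into (A + B) d^s. Taking s = 1 gives a contraction, and s = t gives the
    hypothesis of [sublinear_decay]. *)
Lemma rate_of_recursion (R : realType) (a : nat -> R) (A B t : R) :
  0 < A -> 0 < B -> 0 < t -> a @ \oo --> 0 ->
  (forall k, 0 <= a k /\ a k.+1 <= a k) ->
  (\forall k \near \oo, a k.+1 <= A * (a k - a k.+1) `^ t + B * (a k - a k.+1)) ->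
  (1 <= t -> exists c : R, [/\ 0 < c, c < 1 &
     \forall k \near \oo, a k.+1 <= c * a k]) /\
  (t < 1 -> exists C : R,
     \forall k \near \oo, a k <= C / k%:R `^ (t / (1 - t))).
Proof.
move=> A0 B0 t0 /cvgrPdist_lt/(_ _ ltr01) [K1 _ aK1] a_decr [K2 _ aK2].
pose K := maxn K1 K2.
have AB0 : 0 < A + B by rewrite addr_gt0.
have diff01 k : (K <= k)%N -> 0 <= a k - a k.+1 <= 1.
  rewrite geq_max => /andP[Kk _]; have [ak ak1] := a_decr k.
  have [ak10 _] := a_decr k.+1.
  by have := aK1 k Kk; rewrite sub0r normrN ger0_norm// => ?; apply/andP; split; lra.
have rec (s : R) k : (K <= k)%N -> s <= t -> 0 < s -> s <= 1 ->
    a k.+1 <= (A + B) * (a k - a k.+1) `^ s.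
  move=> Kk st s0 s1; have /andP[d0 d1] := diff01 k Kk.
  have := aK2 k (leq_trans (leq_maxr _ _) Kk).
  set d := a k - a k.+1 in d0 d1 * => h.
  move: d0; rewrite le_eqVlt => /predU1P[d0|d0].
    by move: h; rewrite -d0 !powR0 ?gt_eqF// !mulr0 addr0.
  have d01 : 0 < d <= 1 by rewrite d0.
  have h1 := ler_wpM2l (ltW A0) (ger_powR d01 st).
  have h2 := ler_wpM2l (ltW B0) (ger1_powR d01 s1).
  rewrite mulrDl; lra.
split=> t1.
- exists ((A + B) / (A + B + 1)); split.
  + by rewrite divr_gt0// addr_gt0.
  + by rewrite ltr_pdivrMr ?mul1r ?ltrDl// addr_gt0.
  + exists K => // k /= Kk; have /andP[d0 _] := diff01 k Kk.
    have h := rec 1 k Kk t1 ltr01 (lexx _).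
    rewrite mulrAC ler_pdivlMr ?addr_gt0//.
    by move: h; rewrite powRr1//; lra.
- have [k Kk|C HC] := @sublinear_decay _ a (A + B) t K AB0 t0 t1.
    by split; [have [] := a_decr k| have [] := a_decr k|exact: rec (ltW _)].
  exists C; exists (maxn 1 K) => // k /=; rewrite geq_max => /andP[k0 Kk].
  exact: HC.
Qed.

Lemma nonincreasing_subseq_cvg (R : realType) (b : nat -> R) (s : nat -> nat)
    (l : R) :
  {homo b : i j / (i <= j)%N >-> j <= i} -> increasing_seq s ->
  (b \o s) @ \oo --> l -> (forall k, l <= b k) /\ b @ \oo --> l.
Proof.
move=> b_decr s_incr bs.
have s_ge k : (k <= s k)%N.
  elim: k => // k IH; rewrite (leq_ltn_trans IH)//.
  by move/increasing_seqP : s_incr; exact.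
have lb k : l <= b k.
  rewrite leNgt; apply/negP => blk.
  move/cvgrPdist_lt : bs => /(_ (l - b k)); rewrite subr_gt0 => /(_ blk)[N _ HN].
  have := HN (maxn N k) (leq_maxl _ _) => /=.
  have := b_decr _ _ (leq_trans (leq_maxr N k) (s_ge _)).
  by rewrite ltr_norml => ? /andP[]; lra.
split=> //; apply/cvgrPdist_lt => e e0.
move/cvgrPdist_lt : bs => /(_ _ e0)[N _ HN].
exists (s N) => // k /= /b_decr bk; have /= := HN N (leqnn N).
by have := lb k; have := lb (s N); rewrite !ltr_norml => ? ? /andP[? ?];
  apply/andP; split; lra.
Qed.

(** * Euclidean inner product and norm, and their link with the sup-norm topology *)

Lemma edotC (R : realType) (n : nat) (u v : 'rV[R]_n) : edot u v = edot v u.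
Proof. by apply: eq_bigr => i _; rewrite mulrC. Qed.

Lemma edotDl (R : realType) (n : nat) (u v w : 'rV[R]_n) :
  edot (u + v) w = edot u w + edot v w.
Proof. by rewrite -big_split/=; apply: eq_bigr => i _; rewrite mxE mulrDl. Qed.

Lemma edotZl (R : realType) (n : nat) (a : R) (u v : 'rV[R]_n) :
  edot (a *: u) v = a * edot u v.
Proof. by rewrite big_distrr/=; apply: eq_bigr => i _; rewrite mxE mulrA. Qed.

Lemma edotDr (R : realType) (n : nat) (u v w : 'rV[R]_n) :
  edot w (u + v) = edot w u + edot w v.
Proof. by rewrite edotC edotDl !(edotC _ w). Qed.

Lemma edotZr (R : realType) (n : nat) (a : R) (u v : 'rV[R]_n) :
  edot u (a *: v) = a * edot u v.
Proof. by rewrite edotC edotZl edotC. Qed.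

Lemma edot_ge0 (R : realType) (n : nat) (u : 'rV[R]_n) : 0 <= edot u u.
Proof. by apply: sumr_ge0 => i _; rewrite -expr2 sqr_ge0. Qed.

Lemma enorm_ge0 (R : realType) (n : nat) (u : 'rV[R]_n) : 0 <= enorm u.
Proof. exact: sqrtr_ge0. Qed.

Lemma sqr_enorm (R : realType) (n : nat) (u : 'rV[R]_n) :
  enorm u ^+ 2 = edot u u.
Proof. by rewrite sqr_sqrtr// edot_ge0. Qed.

Lemma coord_le_enorm (R : realType) (n : nat) (u : 'rV[R]_n) i :
  `|u ord0 i| <= enorm u.
Proof.
rewrite -sqrtr_sqr ler_sqrt ?edot_ge0// /edot (bigD1 i)//= -expr2 lerDl.
by apply: sumr_ge0 => j _; rewrite -expr2 sqr_ge0.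
Qed.

Lemma enorm0 (R : realType) (n : nat) : enorm (0 : 'rV[R]_n) = 0.
Proof.
by rewrite /enorm /edot big1 ?sqrtr0// => i _; rewrite mxE mul0r.
Qed.

Lemma enorm_eq0 (R : realType) (n : nat) (u : 'rV[R]_n) :
  (enorm u == 0) = (u == 0).
Proof.
apply/eqP/eqP => [u0|->]; last exact: enorm0.
apply/rowP => i; rewrite mxE; apply/eqP; rewrite -normr_le0 -u0.
exact: coord_le_enorm.
Qed.

Lemma enorm_gt0 (R : realType) (n : nat) (u : 'rV[R]_n) :
  (0 < enorm u) = (u != 0).
Proof. by rewrite lt_def enorm_ge0 andbT enorm_eq0. Qed.

Lemma enormZ (R : realType) (n : nat) (a : R) (u : 'rV[R]_n) :
  enorm (a *: u) = `|a| * enorm u.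
Proof.
by rewrite /enorm edotZl edotZr mulrA -expr2 sqrtrM ?sqr_ge0// sqrtr_sqr.
Qed.

Lemma enormN (R : realType) (n : nat) (u : 'rV[R]_n) : enorm (- u) = enorm u.
Proof. by rewrite -scaleN1r enormZ normrN1 mul1r. Qed.

Lemma enormB (R : realType) (n : nat) (u v : 'rV[R]_n) :
  enorm (u - v) = enorm (v - u).
Proof. by rewrite -opprB enormN. Qed.

(** Cauchy-Schwarz: the squared norm of |v|^2 u - <u, v> v equals |v|^2 (|u|^2 |v|^2 - <u, v>^2). *)
Lemma edot_le (R : realType) (n : nat) (u v : 'rV[R]_n) :
  edot u v <= enorm u * enorm v.
Proof.
have [->|v0] := eqVneq v 0.
  by rewrite enorm0 mulr0 /edot big1// => i _; rewrite mxE mulr0.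
set b := edot u v; have c0 : 0 < enorm v by rewrite enorm_gt0.
have : 0 <= edot (enorm v ^+ 2 *: u - b *: v) (enorm v ^+ 2 *: u - b *: v).
  exact: edot_ge0.
rewrite -scaleNr !(edotDl, edotDr, edotZl, edotZr) (edotC v u) -!sqr_enorm -/b.
rewrite [X in 0 <= X -> _](_ : _ =
    enorm v ^+ 2 * ((enorm u * enorm v) ^+ 2 - b ^+ 2)); last by ring.
rewrite pmulr_rge0 ?exprn_gt0// subr_ge0 -ler_sqrt ?sqr_ge0//.
rewrite !sqrtr_sqr (ger0_norm (mulr_ge0 (enorm_ge0 _) (enorm_ge0 _))).
by apply: le_trans; rewrite ler_norm.
Qed.

Lemma enormD (R : realType) (n : nat) (u v : 'rV[R]_n) :
  enorm (u + v) <= enorm u + enorm v.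
Proof.
rewrite -(@ler_pXn2r _ 2)// ?nnegrE ?addr_ge0 ?enorm_ge0//.
rewrite sqr_enorm !(edotDl, edotDr) (edotC v u) sqrrD -!sqr_enorm.
have := edot_le u v; lra.
Qed.

Lemma mx_norm_le_enorm (R : realType) (n : nat) (u : 'rV[R]_n) :
  `|u| <= enorm u.
Proof.
rewrite [leLHS]/Num.norm/= mx_normrE; apply/bigmax_leP; split=> [|[i j] _ /=].
  exact: enorm_ge0.
by rewrite ord1; exact: coord_le_enorm.
Qed.

Lemma enorm_continuous (R : realType) (n : nat) :
  continuous (@enorm R n).
Proof.
move=> u; apply: (@continuous_comp _ _ _ (fun v : 'rV[R]_n => edot v v) Num.sqrt).
  apply: (@continuous_big _ _ +%R 0) => [|i _]; first exact: add_continuous.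
  have ci : continuous (fun v : 'rV[R]_n => v ord0 i) by exact: coord_continuous.
  by move=> v; exact: (continuousM (ci v) (ci v)).
exact: sqrt_continuous.
Qed.

Lemma enorm_sub_continuous (R : realType) (n : nat) (z : 'rV[R]_n) :
  continuous (fun y : 'rV[R]_n => enorm (y - z)).
Proof.
have cz : continuous (fun v : 'rV[R]_n => v - z).
  by move=> v; apply: continuousB => //; exact: cst_continuous.
by move=> y; exact: (continuous_comp (cz y) (@enorm_continuous _ _ _)).
Qed.

Lemma nbhs_enorm (R : realType) (n : nat) (z : 'rV[R]_n) (V : set 'rV[R]_n) :
  nbhs z V -> exists2 e, 0 < e & forall y, enorm (y - z) <= e -> V y.
Proof.
move=> /nbhs_ballP[e /= e0 zeV]; exists (e / 2); first exact: divr_gt0.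
move=> y yz; apply: zeV; rewrite -ball_normE/=.
rewrite (le_lt_trans (mx_norm_le_enorm _))// enormB (le_lt_trans yz)//.
by rewrite ltr_pdivrMr// ltr_pMr// ltr1n.
Qed.

Lemma enorm_nbhs (R : realType) (n : nat) (z : 'rV[R]_n) (e : R) :
  0 < e -> \forall y \near z, enorm (y - z) < e.
Proof.
move=> e0; have := @enorm_sub_continuous R n z z.
move=> /cvgrPdist_lt/(_ _ e0); apply: filterS => y.
by rewrite subrr enorm0 sub0r normrN ger0_norm// enorm_ge0.
Qed.

(** * Taylor remainder bounds, from the real line to the composite function *)

(** Repeated integration of a linear bound, without integrals: induction on the shifted family
    bounds [G 1], and then [G 0] minus the monomial whose derivative is that bound is monotone. The
    bound is one-sided so that it can be applied to a function and to its opposite. *)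
Lemma iterated_primitive_le (R : realType) (p : nat) (G : nat -> R -> R)
    (L : R) :
  (forall j, (j < p)%N -> forall t : R, is_derive t (1 : R) (G j) (G j.+1 t)) ->
  (forall j, (j < p)%N -> G j 0 = 0) ->
  (forall t : R, 0 <= t -> G p t <= L * t) ->
  forall t : R, 0 <= t -> G 0%N t <= L / p.+1`!%:R * t ^+ p.+1.
Proof.
elim: p G => [|p IH] G dG G0 Gp t t0; first by rewrite factS fact0 divr1 expr1 Gp.
have G1 : forall s : R, 0 <= s -> G 1%N s <= L / p.+1`!%:R * s ^+ p.+1.
  by apply: (IH (fun j => G j.+1)) => // j jp; [exact: dG|exact: G0].
have dG0 s := dG 0%N (ltn0Sn _) s.
pose Q : {poly R} := (L / p.+2`!%:R) *: 'X^(p.+2).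
have QE s : Q.[s] = L / p.+2`!%:R * s ^+ p.+2 by rewrite hornerZ hornerXn.
have dQE s : Q^`().[s] = L / p.+1`!%:R * s ^+ p.+1.
  rewrite derivZ derivXn hornerZ hornerMn hornerXn -mulr_natl factS natrM.
  by field; rewrite -natrD !pnatr_eq0 -!lt0n fact_gt0.
pose D (s : R) : R := Q.[s] - G 0%N s.
have dD (s : R) : is_derive s (1 : R) D (Q^`().[s] - G 1%N s).
  exact: is_deriveB.
have : D 0 <= D t.
  apply: (@ger0_derive1_ndecry _ D 0) => // [s|].
  - rewrite in_itv/= andbT => s0; rewrite derive1E derive_val subr_ge0.
    by rewrite dQE G1// ltW.
  - apply: continuous_subspaceT => s.
    by apply/differentiable_continuous/derivable1_diffP.
by rewrite /D !QE G0// expr0n mulr0 subr0 subr_ge0.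
Qed.

(** Subtracting the Taylor polynomial makes the derivatives of order below p vanish at 0, and turns
    the one of order p into [H p t - H p 0], since the polynomial has constant p-th derivative. No
    derivative of order p + 1 has to exist. *)
Lemma taylor_remainder_le (R : realType) (p : nat) (H : nat -> R -> R) (L : R) :
  (forall j, (j < p)%N -> forall t : R, is_derive t (1 : R) (H j) (H j.+1 t)) ->
  (forall t : R, 0 <= t -> `|H p t - H p 0| <= L * t) ->
  `|H 0%N 1 - \sum_(i < p.+1) H i 0 / i`!%:R| <= L / p.+1`!%:R.
Proof.
move=> dH HL.
pose P := \poly_(i < p.+1) (H i 0 / i`!%:R).
have fact_neq0 i : (i`!%:R : R) != 0 by rewrite pnatr_eq0 -lt0n fact_gt0.
have P0 j : (j <= p)%N -> (P^`(j)).[0] = H j 0.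
  move=> jp; rewrite horner_coef0 coef_derivn addn0 coef_poly ltnS jp.
  by rewrite ffactnn -[LHS]mulr_natr divfK.
have Pp : P^`(p) = (H p 0)%:P.
  apply/polyP => i; rewrite coefC coef_derivn; case: i => [|i] /=.
    by rewrite addn0 coef_poly ltnSn ffactnn -[LHS]mulr_natr divfK.
  by rewrite coef_poly addnS ltnS ltnNge leq_addr mul0rn.
have dE j : (j < p)%N -> forall t : R,
    is_derive t (1 : R) (fun s => H j s - (P^`(j)).[s])
      (H j.+1 t - (P^`(j.+1)).[t]).
  by move=> jp t; rewrite derivnS; apply: is_deriveB; exact: dH.
have E1 : (P^`(0)).[1] = \sum_(i < p.+1) H i 0 / i`!%:R.
  by rewrite derivn0 horner_poly; apply: eq_bigr => i _; rewrite expr1n mulr1.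
rewrite -E1 ler_norml; apply/andP; split.
- rewrite lerNl.
  have := @iterated_primitive_le R p (fun j s => - (H j s - (P^`(j)).[s])) L.
  move=> /(_ _ _ _ 1); rewrite expr1n mulr1; apply => //.
  + by move=> j jp t; apply: is_deriveN; exact: dE.
  + by move=> j jp; rewrite P0 ?subrr ?oppr0// ltnW.
  + move=> t t0; rewrite Pp hornerC; apply: le_trans (HL t t0).
    by rewrite -normrN ler_norm.
- have := @iterated_primitive_le R p (fun j s => H j s - (P^`(j)).[s]) L dE.
  move=> /(_ _ _ 1); rewrite expr1n mulr1; apply => //.
  + by move=> j jp; rewrite P0 ?subrr// ltnW.
  + move=> t t0; rewrite Pp hornerC; apply: le_trans (HL t t0).
    exact: ler_norm.
Qed.

Lemma is_derive_line (R : realType) (n : nat) (phi : 'rV[R]_n -> R)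
    (x d : 'rV[R]_n) (t : R) : differentiable phi (x + t *: d) ->
  is_derive t (1 : R) (fun s => phi (x + s *: d)) ('d phi (x + t *: d) d).
Proof.
move=> dphi.
have E : (fun h : R => h^-1 *: (((fun s => phi (x + s *: d)) \o shift t) (h *: (1 : R))
                        - phi (x + t *: d))) =
         (fun h : R => h^-1 *: ((phi \o shift (x + t *: d)) (h *: d)
                        - phi (x + t *: d))).
  apply/funext => h /=; congr (_ *: (phi _ - _)).
  by rewrite [h *: 1]mulr1 scalerDl addrCA.
have := diff_derivable (v := d) dphi.
rewrite /derivable -E => ex; split; first exact: ex.
by rewrite -deriveE// /derive E.
Qed.

(** Multilinearity is not built into [Dform]: the outermost slot is linear as a differential, but a
    scalar from an inner slot must be pulled through a differentiation, which uses differentiability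
    of the inner form. *)
Lemma Dform_homogeneous (R : realType) (n p : nat) (phi : 'rV[R]_n -> R)
    (c : R) (d : 'rV[R]_n) (j : nat) :
  times_differentiable p phi -> (j <= p)%N ->
  Dform phi (nseq j (c *: d)) = c ^+ j \*: Dform phi (nseq j d).
Proof.
move=> dphi; elim: j => [_|j IH jp]; first by apply/funext => y /=; rewrite expr0 scale1r.
apply/funext => y /=; rewrite IH ?(ltnW jp)// diffZ; last first.
  by apply: dphi; rewrite size_nseq.
by rewrite /= linearZ/= scalerA exprSr.
Qed.

Lemma taylor_poly_bound (R : realType) (n p : nat) (phi : 'rV[R]_n -> R)
    (L : R) (x y : 'rV[R]_n) :
  times_differentiable p phi -> Dform_lipschitz p phi L -> (0 < p)%N ->
  `|phi y - taylor_poly p phi y x| <= L / p.+1`!%:R * enorm (y - x) ^+ p.+1.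
Proof.
move=> dphi Lphi p0; set d := y - x.
have -> : taylor_poly p phi y x =
    \sum_(i < p.+1) Dform phi (nseq i d) (x + 0 *: d) / i`!%:R.
  rewrite /taylor_poly big_ord_recl/= fact0 divr1 scale0r addr0; congr (_ + _).
  by rewrite big_add1 big_mkord; apply: eq_bigr => i _; rewrite mulrC.
have -> : phi y = Dform phi (nseq 0 d) (x + 1 *: d).
  by rewrite /= scale1r addrC subrK.
rewrite mulrAC.
apply: (@taylor_remainder_le _ p (fun j t => Dform phi (nseq j d) (x + t *: d))).
  move=> j jp t; apply: (@is_derive_line _ _ (Dform phi (nseq j d))).
  by apply: dphi; rewrite size_nseq.
move=> t t0; rewrite scale0r addr0.
have [d0|d0] := eqVneq d 0.
  by rewrite d0 enorm0 expr0n mulr0 mul0r scaler0 addr0 subrr normr0.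
have ed0 : 0 < enorm d by rewrite enorm_gt0.
(* The operator norm tests unit vectors only. Normalising d yields p factors of |d| by homogeneity;
   the last one comes from the displacement t d in the Lipschitz bound. *)
set u := (enorm d)^-1 *: d.
have du : d = enorm d *: u by rewrite scalerA divff ?scale1r// gt_eqF.
have u1 : enorm u = 1.
  by rewrite enormZ ger0_norm ?invr_ge0 ?ltW// mulVf// gt_eqF.
have Lu : `|Dform phi (nseq p u) (x + t *: d) - Dform phi (nseq p u) x|
    <= L * (t * enorm d).
  have := Lphi (x + t *: d) x.
  rewrite addrAC subrr add0r enormZ (ger0_norm t0) => Lu.
  rewrite -lee_fin; apply: le_trans Lu; apply: ereal_sup_ubound.
  exists (nseq p u) => //; split; first by rewrite size_nseq.
  by move=> v /nseqP[-> _]; rewrite u1.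
rewrite [in nseq p d]du (Dform_homogeneous (p := p))//=.
rewrite -scalerBr normrM ger0_norm; last by rewrite exprn_ge0// ltW.
apply: (le_trans (ler_wpM2l _ Lu)); first by rewrite exprn_ge0// ltW.
by rewrite exprSr; lra.
Qed.

Lemma enorm_le_coord (R : realType) (n : nat) (w v : 'rV[R]_n) (c : R) :
  0 <= c -> (forall i, `|w ord0 i| <= v ord0 i * c) -> enorm w <= enorm v * c.
Proof.
move=> c0 wv; rewrite mulrC -(ger0_norm c0) -enormZ.
rewrite ler_sqrt ?edot_ge0//; apply: ler_sum => i _; rewrite -!expr2 mxE.
rewrite -real_normK ?num_real// -[leRHS]real_normK ?num_real//.
by rewrite lerXn2r ?nnegrE// (le_trans (wv i))// [c * _]mulrC ler_norm.
Qed.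

Lemma enorm_le_mx_norm (R : realType) (n : nat) (u : 'rV[R]_n) :
  enorm u <= enorm (const_mx 1 : 'rV[R]_n) * `|u|.
Proof.
apply: enorm_le_coord => // i; rewrite mxE mul1r [leRHS]/Num.norm/= mx_normrE.
by apply/bigmax_geP; right; exists (ord0, i).
Qed.

Lemma bounded_fun_enorm (R : realType) (n : nat) (x : nat -> 'rV[R]_n) :
  bounded_fun x -> exists C, forall k, enorm (x k) <= C.
Proof.
move=> [M [_ HM]]; exists (enorm (const_mx 1 : 'rV[R]_n) * (M + 1)) => k.
rewrite (le_trans (enorm_le_mx_norm _))// ler_wpM2l ?enorm_ge0//.
by apply: HM => //; rewrite ltrDl.
Qed.

(** For m = 0 the Lipschitz condition does not determine the sign of [Lg], so nonnegativity is
    obtained for the product. *)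
Lemma elipschitz_mul_enorm_ge0 (R : realType) (m : nat) (g : 'rV[R]_m -> R)
    (Lg : R) (v : 'rV[R]_m) : elipschitz g Lg -> 0 <= Lg * enorm v.
Proof. by move=> /(_ v 0); rewrite subr0; exact: le_trans. Qed.

Lemma elipschitz_le (R : realType) (m : nat) (g : 'rV[R]_m -> R)
    (Lg c : R) (u w v : 'rV[R]_m) : elipschitz g Lg -> 0 <= c ->
  enorm (u - w) <= enorm v * c -> `|g u - g w| <= Lg * enorm v * c.
Proof.
move=> gL c0 uwv; apply: (le_trans (gL u w)).
have [L0|L0] := leP 0 Lg; first by rewrite -mulrA ler_wpM2l.
apply: (@le_trans _ _ 0); first by rewrite mulr_le0_ge0 ?enorm_ge0// ltW.
by rewrite mulr_ge0//; exact: elipschitz_mul_enorm_ge0 gL.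
Qed.

Lemma composite_taylor_bound (R : realType) (n m p : nat)
    (F : 'rV[R]_n -> 'rV[R]_m) (g : 'rV[R]_m -> R) (Lp : 'rV[R]_m) (Lg : R)
    (x y : 'rV[R]_n) :
  (0 < p)%N ->
  (forall i, times_differentiable p (component F i)) ->
  (forall i, Dform_lipschitz p (component F i) (Lp ord0 i)) ->
  elipschitz g Lg ->
  `|g (F y) - g (taylor_map p F y x)|
    <= Lg * enorm Lp / p.+1`!%:R * enorm (y - x) ^+ p.+1.
Proof.
move=> p0 dF LF gL; rewrite -mulrA.
apply: elipschitz_le => //.
  by rewrite mulr_ge0 ?invr_ge0 ?exprn_ge0 ?enorm_ge0// ler0n.
apply: enorm_le_coord; first by rewrite mulr_ge0 ?invr_ge0 ?exprn_ge0 ?enorm_ge0// ler0n.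
by move=> i; rewrite !mxE mulrA; exact: taylor_poly_bound.
Qed.

Lemma elipschitz_comp_continuous (R : realType) (n m : nat)
    (F : 'rV[R]_n -> 'rV[R]_m) (g : 'rV[R]_m -> R) (Lg : R) :
  (forall i, continuous (component F i)) -> elipschitz g Lg ->
  continuous (fun y => g (F y)).
Proof.
move=> cF gL x.
have cE : continuous (fun y : 'rV[R]_n => enorm (F x - F y)).
  rewrite (_ : (fun y => _) = (Num.sqrt \o (fun y : 'rV[R]_n =>
      \sum_i (component F i x - component F i y) * (component F i x - component F i y)))).
    move=> y; apply: continuous_comp; last exact: sqrt_continuous.
    apply: (@continuous_big _ _ +%R 0) => [|i _]; first exact: add_continuous.
    have ci : continuous (fun y : 'rV[R]_n => component F i x - component F i y).
      by move=> z; exact: (continuousB (@cst_continuous _ _ _ _) (cF i z)).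
    by move=> z; exact: (continuousM (ci z) (ci z)).
  apply/funext => y; rewrite /enorm /edot /=; congr Num.sqrt.
  by apply: eq_bigr => i _; rewrite !mxE.
have cLE : {for x, continuous (fun y : 'rV[R]_n => Lg * enorm (F x - F y))}.
  by apply: continuousM; [exact: cst_continuous|exact: cE].
move: cLE => /cvgrPdist_lt cx; apply/(@cvgrPdist_lt _ _ _ (nbhs x)) => e e0.
apply: filterS (cx e e0) => y; rewrite subrr enorm0 mulr0 sub0r normrN.
move=> /(le_lt_trans _); apply.
by apply: (le_trans (gL _ _)); exact: ler_norm.
Qed.

(** * Subgradients at minimisers of a function plus a power of the distance *)

Lemma exprn_le_quadratic (R : realFieldType) (a : R) (n : nat) : 0 <= a ->
  exists2 K : R, 0 <= K & forall b : R, 0 <= b -> b <= a + 1 ->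
    b ^+ n.+1 <= a ^+ n.+1 + n.+1%:R * a ^+ n * (b - a) + K * (b - a) ^+ 2.
Proof.
move=> a0; elim: n => [|n [K K0 IH]].
  by exists 0 => // b _ _; rewrite !expr1 expr0 mul0r; lra.
have an0 : 0 <= a ^+ n by rewrite exprn_ge0.
(* Multiplying the bound by b = a + (b - a) leaves the cross term (n+1) a^n (b - a)^2, and b <= a +
   1 bounds the factor K b. *)
exists (n.+1%:R * a ^+ n + K * (a + 1)).
  by rewrite addr_ge0// mulr_ge0//; lra.
move=> b b0 ba; rewrite exprSr; apply: (le_trans (ler_wpM2r b0 (IH b b0 ba))).
rewrite -subr_ge0.
have : 0 <= K * (a + 1 - b) * (b - a) ^+ 2.
  by rewrite mulr_ge0 ?sqr_ge0// mulr_ge0// subr_ge0.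
rewrite -[n.+2%:R]natr1 !exprS; lra.
Qed.

Lemma enorm_sub_le (R : realType) (n : nat) (u v : 'rV[R]_n) :
  (enorm u - enorm v) ^+ 2 <= enorm (u - v) ^+ 2.
Proof.
rewrite !sqr_enorm -(scaleN1r v) !(edotDl, edotDr, edotZl, edotZr) (edotC v u).
rewrite sqrrB -!sqr_enorm; have := edot_le u v; lra.
Qed.

(* The estimate [a (b - a) <= <u, d> + |d|^2], where [a = |u|] and
   [b = |u + d|], replaces differentiating the norm. *)
Lemma enorm_expr_le (R : realType) (n p : nat) (u : 'rV[R]_n) :
  exists2 K : R, 0 <= K & forall d : 'rV[R]_n, enorm d <= 1 ->
    enorm (u + d) ^+ p.+2 <=
      enorm u ^+ p.+2 + p.+2%:R * enorm u ^+ p * edot u d + K * enorm d ^+ 2.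
Proof.
have [K K0 HK] := exprn_le_quadratic p.+1 (enorm_ge0 u).
have c0 : 0 <= p.+2%:R * enorm u ^+ p by rewrite mulr_ge0// exprn_ge0// enorm_ge0.
exists (K + p.+2%:R * enorm u ^+ p).
  by rewrite addr_ge0.
move=> d d1; have ud := enormD u d.
have := HK _ (enorm_ge0 (u + d)); move=> /(_ _)/le_trans; apply; first by lra.
have h1 := enorm_sub_le (u + d) u; rewrite addrAC subrr add0r in h1.
have h2 : enorm u * (enorm (u + d) - enorm u) <= edot u d + enorm d ^+ 2.
  have : enorm (u + d) ^+ 2 = enorm u ^+ 2 + 2 * edot u d + enorm d ^+ 2.
    by rewrite !sqr_enorm !(edotDl, edotDr) (edotC d u); ring.
  have := sqr_ge0 (enorm (u + d) - enorm u); have := sqr_ge0 (enorm d); nra.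
have h3 := ler_wpM2l c0 h2; have h4 := ler_wpM2l K0 h1.
(* One factor |u| is split off because [h2] bounds |u| (|u + d| - |u|), not the difference alone;
   the exponent [p.+2] leaves room for it. *)
rewrite [enorm u ^+ p.+1]exprSr.
lra.
Qed.

(** Fermat's rule: the vector is minus the gradient at y of c |. - x|^(p+2). Minimality and
    [enorm_expr_le] bound the difference quotient below by -c K |z - y|. *)
Lemma penalized_min_frechet (R : realType) (n p : nat) (f : 'rV[R]_n -> \bar R)
    (c : R) (x y : 'rV[R]_n) : 0 <= c -> f y \is a fin_num ->
  (forall z, (f y + (c * enorm (y - x) ^+ p.+2)%R%:E
              <= f z + (c * enorm (z - x) ^+ p.+2)%R%:E)%E) ->
  frechet_subdiff f y (- (c * p.+2%:R * enorm (y - x) ^+ p) *: (y - x)).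
Proof.
move=> c0 fy ymin; split; first by rewrite /edom/= ltey_eq fy.
rewrite limf_einfE; apply/lee_addgt0Pr => e e0.
have [K K0 HK] := enorm_expr_le p (y - x).
set v := _ *: _.
have K1 : 0 < c * K + 1 by rewrite ltr_wpDl// mulr_ge0.
(* The bound 1 is the range of [enorm_expr_le]; the other makes c K |z - y| <= e, with + 1 guarding
   against a zero denominator. *)
pose r := Num.min 1 (e / (c * K + 1)).
have r0 : 0 < r by rewrite lt_min ltr01 divr_gt0.
pose V := [set z | enorm (z - y) < r /\ z != y].
have VF : y^' V.
  rewrite /V; near=> z; split; first by near: z; apply: nbhs_dnbhs; exact: enorm_nbhs.
  by near: z; exact: nbhs_dnbhs_neq.
rewrite -leeBlDr// sub0e; apply: le_trans; last first.
  by apply: ereal_sup_ubound; exists V.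
apply: le_ereal_inf_tmp => _ [z [zr zy] <-].
have zy0 : 0 < enorm (z - y) by rewrite enorm_gt0 subr_eq0.
have := ymin z; rewrite -(fineK fy).
have zr1 : enorm (z - y) <= 1 by rewrite ltW// (lt_le_trans zr)// ge_min lexx.
have := HK _ zr1; rewrite addrC subrKA.
have zr2 : enorm (z - y) * (c * K + 1) <= e.
  by rewrite -ler_pdivlMr// ltW// (lt_le_trans zr)// ge_min lexx orbT.
case: (f z) => [s| |] Hz.
- rewrite -!EFinD !lee_fin => H.
  rewrite ler_pdivlMr// /v edotZl.
  have := ler_wpM2l c0 Hz.
  have zr3 := ler_wpM2r (ltW zy0) zr2.
  nra.
- by move=> _; rewrite !addye// gt0_mulye ?leey// lte_fin invr_gt0.
- by rewrite addNye leeNy_eq.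
Unshelve. all: by end_near. Qed.

Lemma subdiff_slope_ge0 (R : realType) (n : nat) (f : 'rV[R]_n -> \bar R) y :
  (0 <= subdiff_slope f y)%E.
Proof. by apply: le_ereal_inf_tmp => _ [z _ <-]; rewrite lee_fin enorm_ge0. Qed.

Lemma penalized_min_slope (R : realType) (n p : nat) (f : 'rV[R]_n -> \bar R)
    (c : R) (x y : 'rV[R]_n) : 0 <= c -> f y \is a fin_num ->
  (forall z, (f y + (c * enorm (y - x) ^+ p.+2)%R%:E
              <= f z + (c * enorm (z - x) ^+ p.+2)%R%:E)%E) ->
  (subdiff_slope f y <= (c * p.+2%:R * enorm (y - x) ^+ p.+1)%R%:E)%E.
Proof.
move=> c0 fy /(penalized_min_frechet c0 fy) vf.
apply: ereal_inf_lbound; exists (- (c * p.+2%:R * enorm (y - x) ^+ p) *: (y - x)).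
  split; first by rewrite /edom/= ltey_eq fy.
  exists (fun=> y), (fun=> - (c * p.+2%:R * enorm (y - x) ^+ p) *: (y - x)).
  by split; try exact: cvg_cst.
rewrite sub0r enormN enormZ normrN ger0_norm ?exprSr ?mulrA//.
by rewrite !mulr_ge0// exprn_ge0// enorm_ge0.
Qed.

(** * Compactness: existence of minimisers and limit points *)

Lemma bounded_seq_clusters (R : realType) (n : nat) (x : nat -> 'rV[R]_n)
    (C : R) : (forall k, enorm (x k) <= C) ->
  exists z, forall e N, 0 < e -> exists2 k, (N <= k)%N & enorm (x k - z) < e.
Proof.
move=> xC; pose K := [set v : 'rV[R]_n | enorm v <= C].
have cK : compact K.
  apply: bounded_closed_compact.
    exists C; split; first exact: num_real.
    by move=> M CM v /= vC; rewrite (le_trans (mx_norm_le_enorm v))// (le_trans vC)// ltW.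
  rewrite /K (_ : [set v | _] = @enorm R n @^-1` [set r | r <= C])//.
  by apply: preimage_closed; [move=> v _; exact: enorm_continuous|exact: closed_le].
have [z [_ xz]] : K `&` cluster (x @ \oo) !=set0.
  by apply: cK; exists 0%N => // k _; exact: xC.
exists z => e N e0.
have [_ [[k Nk <-] xke]] := xz [set x k | k in [set k | (N <= k)%N]] _
  (ltac:(exists N => // k Nk; exists k => //)) (enorm_nbhs z e0).
by exists k.
Qed.

Lemma lower_semicontinuous_attains_min (R : realType) (n : nat)
    (phi : 'rV[R]_n -> \bar R) (c C : R) (x0 : 'rV[R]_n) :
  lower_semicontinuous phi -> (forall y, (c%:E <= phi y)%E) ->
  (phi x0 < +oo)%E ->
  (forall y, (phi y <= phi x0)%E -> enorm y <= C) ->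
  exists y, forall z, (phi y <= phi z)%E.
Proof.
move=> lsc phi_c phi0 phi_C.
pose m := ereal_inf (range phi).
have m0 : (m <= phi x0)%E by apply: ereal_inf_lbound; exists x0.
have cm : (c%:E <= m)%E by apply: le_ereal_inf_tmp => _ [y _ <-].
have mfin : m \is a fin_num.
  by rewrite fin_numElt (lt_le_trans (ltNyr c) cm) (le_lt_trans m0 phi0).
(* If x0 is not already a minimiser, m lies strictly below [phi x0], so a minimising sequence can be
   kept in the bounded sublevel set. *)
have [mx0|mx0] := eqVneq m (phi x0).
  by exists x0 => z; rewrite -mx0; apply: ereal_inf_lbound; exists z.
have {}mx0 : (m < phi x0)%E by rewrite lt_neqAle mx0.
have /choice[y Hy] (k : nat) :
    exists y, (phi y <= phi x0)%E /\ (phi y < m + (k.+1%:R^-1)%:E)%E.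
  have : (m < mine (phi x0) (m + (k.+1%:R^-1)%:E))%E.
    by rewrite lt_min mx0/= lteDl// lte_fin invr_gt0 ltr0Sn.
  move=> /ereal_inf_lt[_ [y _ <-]]; rewrite lt_min => /andP[y1 y2].
  by exists y; rewrite ltW.
have [z Hz] := @bounded_seq_clusters R n y C (fun k => phi_C _ (Hy k).1).
exists z => w; apply: (@le_trans _ _ m); last by apply: ereal_inf_lbound; exists w.
rewrite leNgt; apply/negP => mz.
have [e e0 me] : exists2 e : R, 0 < e & (m + e%:E < phi z)%E.
  move: mz; rewrite -(fineK mfin); case: (phi z) => [r| |]//.
  - rewrite lte_fin => mr; exists ((r - fine m) / 2).
      by rewrite divr_gt0// subr_gt0.
    by rewrite -EFinD lte_fin; lra.
  - by move=> _; exists 1 => //; rewrite -EFinD ltry.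
have := lsc z (fine m + e); rewrite EFinD fineK// => /(_ me)[V /nbhs_enorm[r r0 rV] HV].
have /filter_ex[N /= Ne] := near_infty_natSinv_lt (PosNum e0).
have [k Nk /ltW/rV/HV] := Hz r N r0.
apply/negP; rewrite -leNgt ltW//; apply: (lt_le_trans (Hy k).2).
rewrite leeD2l// lee_fin ltW// (le_lt_trans _ Ne)//.
by rewrite lef_pV2 ?posrE ?ltr0Sn// ler_nat ltnS.
Qed.

Lemma lower_semicontinuousD_continuous (R : realType) (n : nat)
    (psi : 'rV[R]_n -> R) (h : 'rV[R]_n -> \bar R) :
  continuous psi -> lower_semicontinuous h ->
  lower_semicontinuous (fun y => (psi y)%:E + h y)%E.
Proof.
move=> cpsi lsc x a ax.
have [b ab bh] : exists2 b : R, a - psi x < b & (b%:E < h x)%E.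
  move: ax; case: (h x) => [r| |].
  - rewrite -EFinD lte_fin => ar; exists ((a - psi x + r) / 2); first lra.
    by rewrite lte_fin; lra.
  - by move=> _; exists (a - psi x + 1); [lra|rewrite ltry].
  - by rewrite addeNy.
have [V Vx HV] := lsc x b bh.
have e0 : 0 < b - (a - psi x) by rewrite subr_gt0.
have /cvgrPdist_lt/(_ _ e0) cx := cpsi x.
exists (V `&` [set t | `|psi x - psi t| < b - (a - psi x)]); first exact: filterI.
move=> y [/HV by' /= py].
apply: (@lt_trans _ _ ((psi y)%:E + b%:E)%E); last by rewrite lteD2lE.
rewrite -EFinD lte_fin; move: py; rewrite ltr_norml; lra.
Qed.

Lemma accumulation_limit_point (R : realType) (n : nat) (x : nat -> 'rV[R]_n)
    (z : 'rV[R]_n) :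
  (forall e N, 0 < e -> exists2 k, (N <= k)%N & enorm (x k - z) < e) ->
  limit_points x z.
Proof.
move=> xz.
have : cluster ((fun k => enorm (x k - z)) @ \oo) 0.
  apply/cluster_eventuallyP => e N e0; have [k Nk ke] := xz e N e0.
  by exists k => //; rewrite sub0r normrN ger0_norm ?enorm_ge0// ltW.
move=> /cluster_eventually_cvg[s s_incr sz]; exists s => //.
move=> V /nbhs_enorm[e e0 eV]; move/cvgrPdist_le : sz => /(_ _ e0).
apply: filterS => k /=; rewrite sub0r normrN ger0_norm ?enorm_ge0// => ke.
exact: eV.
Qed.

(** Otherwise some terms of arbitrarily large index stay far from all limit points; being bounded,
    they accumulate at a point that is itself a limit point of x. *)
Lemma bounded_seq_near_limit_points (R : realType) (n : nat)
    (x : nat -> 'rV[R]_n) (C e : R) :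
  (forall k, enorm (x k) <= C) -> 0 < e ->
  \forall k \near \oo, exists2 z, limit_points x z & enorm (x k - z) < e.
Proof.
move=> xC e0; apply: contrapT => far.
have /choice[t Ht] (N : nat) : exists k, (N <= k)%N /\
    ~ exists2 z, limit_points x z & enorm (x k - z) < e.
  apply: contrapT => no; apply: far; exists N => // k /= Nk.
  by apply: contrapT => xk; apply: no; exists k.
have [z Hz] := @bounded_seq_clusters R n (x \o t) C (fun k => xC (t k)).
have zx : limit_points x z.
  apply: accumulation_limit_point => r N r0; have [k Nk kr] := Hz r N r0.
  by exists (t k) => //; apply: leq_trans (Ht k).1.
have [k _ kz] := Hz e 0%N e0.
by apply: (Ht k).2; exists z.
Qed.

Lemma penalized_attains_min (R : realType) (n p : nat) (psi : 'rV[R]_n -> R)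
    (h : 'rV[R]_n -> \bar R) (c l : R) (x : 'rV[R]_n) :
  continuous psi -> lower_semicontinuous h -> 0 < c ->
  (forall y, (l%:E <= (psi y)%:E + h y)%E) -> ((psi x)%:E + h x < +oo)%E ->
  exists y, forall z,
    ((psi y)%:E + h y + (c * enorm (y - x) ^+ p.+1)%R%:E
      <= (psi z)%:E + h z + (c * enorm (z - x) ^+ p.+1)%R%:E)%E.
Proof.
move=> cpsi lsc c0 hl hx.
have cE : continuous (fun y : 'rV[R]_n => psi y + c * enorm (y - x) ^+ p.+1).
  have cp : continuous (fun y : 'rV[R]_n => enorm (y - x) ^+ p.+1).
    move=> y; exact: (continuous_comp (@enorm_sub_continuous R n x y)
      (@exprn_continuous R p.+1 _)).
  move=> y; exact: (continuousD (cpsi y) (continuousM (@cst_continuous _ _ c y) (cp y))).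
have pen0 y : 0 <= c * enorm (y - x) ^+ p.+1.
  by rewrite mulr_ge0 ?(ltW c0)// exprn_ge0// enorm_ge0.
have phiE y : ((psi y + c * enorm (y - x) ^+ p.+1)%:E + h y
    = (psi y)%:E + h y + (c * enorm (y - x) ^+ p.+1)%R%:E)%E.
  by rewrite EFinD addeAC.
have phix : ((psi x)%:E + h x + (c * enorm (x - x) ^+ p.+1)%R%:E
    = (psi x)%:E + h x)%E.
  by rewrite subrr enorm0 expr0n/= mulr0 adde0.
have hxfin : ((psi x)%:E + h x)%E \is a fin_num.
  by rewrite fin_numElt hx (lt_le_trans (ltNyr l) (hl x)).
(* The lower bound l makes the penalty alone control the sublevel set of x: there |y - x|^(p+1) <=
   B, whence |y - x| <= 1 + |B| without taking roots. *)
pose B := (fine ((psi x)%:E + h x)%E - l) / c.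
have bounded y : ((psi y + c * enorm (y - x) ^+ p.+1)%:E + h y
      <= (psi x + c * enorm (x - x) ^+ p.+1)%:E + h x)%E ->
    enorm y <= enorm x + (1 + `|B|).
  rewrite !phiE phix => yx.
  have yB : enorm (y - x) ^+ p.+1 <= B.
    rewrite ler_pdivlMr// mulrC -lee_fin EFinB fineK// leeBrDr//.
    by apply: le_trans yx; rewrite addeC leeD2r.
  have : enorm (y - x) <= 1 + `|B|.
    have [y1|y1] := leP (enorm (y - x)) 1; first by rewrite (le_trans y1)// lerDl.
    have := ler_norm B; have : enorm (y - x) <= enorm (y - x) ^+ p.+1.
      by rewrite exprS ler_peMr ?enorm_ge0// exprn_ege1// ltW.
    lra.
  by have := enormD x (y - x); rewrite addrC subrK; lra.
have lower y : (l%:E <= (psi y + c * enorm (y - x) ^+ p.+1)%:E + h y)%E.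
  by rewrite phiE (le_trans (hl y))// leeDl// lee_fin.
have finx : ((psi x + c * enorm (x - x) ^+ p.+1)%:E + h x < +oo)%E.
  by rewrite phiE phix.
have [y Hy] := lower_semicontinuous_attains_min
  (lower_semicontinuousD_continuous cE lsc) lower finx bounded.
by exists y => z; rewrite -!phiE.
Qed.

(** * Estimates for one step of the algorithm, then the theorem *)

(* [y] is the minimiser of [f + mu / (p+1)! |. - x|^(p+1)], which lies in the
   ball of radius [D_k] and at which the slope is at most [mu / p! |y - x|^p]. *)
Lemma tensor_step_bounds (R : realType) (n m p : nat)
  (F : 'rV[R]_n -> 'rV[R]_m) (g : 'rV[R]_m -> R) (h : 'rV[R]_n -> \bar R)
  (Lp : 'rV[R]_m) (Lg flow M mu delta : R) (x x1 : 'rV[R]_n)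
  (f := composite_objective F g h) (theta := Lg * enorm Lp)
  (r := enorm (x1 - x) ^+ p.+2 / p.+2`!%:R) :
  (forall i : 'I_m, times_differentiable p.+1 (component F i)) ->
  (forall i : 'I_m, Dform_lipschitz p.+1 (component F i) (Lp ord0 i)) ->
  elipschitz g Lg -> (forall y, h y != -oo%E) -> lower_semicontinuous h ->
  (forall y, (flow%:E <= f y)%E) -> 0 < M -> M + theta < mu -> 0 <= delta ->
  f x \is a fin_num -> f x1 \is a fin_num ->
  (tensor_model p.+1 F g h M x1 x <= tensor_model p.+1 F g h M x x)%E ->
  (tensor_model p.+1 F g h M x1 x
     - tensor_model_min p.+1 F g h M (search_radius p.+1 f mu flow x) x
   <= (delta / p.+2`!%:R * enorm (x1 - x) ^+ p.+2)%R%:E)%E ->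
  fine (f x1) + (M - theta) * r <= fine (f x) /\
  exists y, let rho := enorm (y - x) ^+ p.+2 / p.+2`!%:R in
    [/\ f y \is a fin_num, (f y <= f x)%E,
        mu * rho + fine (f y) <= mu * r + fine (f x1),
        fine (f x1) <= fine (f y) + (M + theta) * rho + (delta - (M - theta)) * r
      & (subdiff_slope f y <= (mu / p.+1`!%:R * enorm (y - x) ^+ p.+1)%:E)%E].
Proof.
move=> dF LF gL hNy lsc flowf M0 Mmu delta0 fx fx1 descent inexact.
have T y := composite_taylor_bound x y (ltn0Sn p) dF LF gL.
have theta0 : 0 <= theta by exact: elipschitz_mul_enorm_ge0 gL.
have mu0 : 0 < mu by lra.
have fact0 : (0 : R) < p.+2`!%:R by rewrite ltr0n fact_gt0.
have fE y : f y = ((g (F y))%:E + h y)%E by [].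
have hfin y : f y \is a fin_num -> h y \is a fin_num.
  by rewrite fE fin_numD => /andP[].
have fineE y : f y \is a fin_num -> fine (f y) = g (F y) + fine (h y).
  by move=> /hfin hy; rewrite fE fineD.
have sE y : f y \is a fin_num -> tensor_model p.+1 F g h M y x =
    (g (taylor_map p.+1 F y x) + M * (enorm (y - x) ^+ p.+2 / p.+2`!%:R)
      + fine (h y))%:E.
  move=> /hfin hy; rewrite /tensor_model -{1}(fineK hy) -!EFinD.
  by congr (_ + _ + _)%:E; rewrite mulrAC mulrA.
have sxx : tensor_model p.+1 F g h M x x = (fine (f x))%:E.
  rewrite sE// fineE// subrr enorm0 expr0n/= mul0r mulr0 addr0.
  have := T x; rewrite subrr enorm0 expr0n/= mulr0 normr_le0 subr_eq0.
  by move=> /eqP ->.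
have Tr y : `|g (F y) - g (taylor_map p.+1 F y x)|
    <= theta * (enorm (y - x) ^+ p.+2 / p.+2`!%:R).
  by have := T y; rewrite mulrAC mulrA.
split.
  move: descent; rewrite sxx sE// lee_fin !fineE// -/r.
  by have := Tr x1; rewrite -/r ler_norml => /andP[]; lra.
have c0 : 0 < mu / p.+2`!%:R by rewrite divr_gt0.
have [||y Hy] := @penalized_attains_min R n p.+1 (fun y => g (F y)) h
    (mu / p.+2`!%:R) flow x _ lsc c0 flowf _.
- apply: elipschitz_comp_continuous gL => i y.
  by apply: differentiable_continuous; exact: (dF i [::]).
- by rewrite -fE ltey_eq fx.
have Hyx := Hy x; rewrite -!fE subrr enorm0 expr0n/= mulr0 adde0 in Hyx.
have pen0 : 0 <= mu / p.+2`!%:R * enorm (y - x) ^+ p.+2.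
  by rewrite mulr_ge0 ?(ltW c0)// exprn_ge0// enorm_ge0.
have fyx : (f y <= f x)%E by apply: le_trans Hyx; rewrite leeDl// lee_fin.
have fy : f y \is a fin_num.
  by rewrite fin_numElt (lt_le_trans (ltNyr flow) (flowf y)) (le_lt_trans fyx)//
    ltey_eq fx.
exists y => rho.
have Hmu : mu * rho = mu / p.+2`!%:R * enorm (y - x) ^+ p.+2.
  by rewrite /rho [RHS]mulrAC -mulrA.
have Hmur : mu * r = mu / p.+2`!%:R * enorm (x1 - x) ^+ p.+2.
  by rewrite /r [RHS]mulrAC -mulrA.
split=> //.
- have := Hy x1; rewrite -!fE -(fineK fy) -(fineK fx1) -!EFinD lee_fin -Hmu -Hmur.
  by rewrite addrC => /le_trans; apply; rewrite addrC.
(* Membership in the ball lets y compete in the model minimum. The Taylor bound then replaces both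
   model values by values of f, at a cost of theta times [rho] and [r]. *)
- have in_ball : enorm (y - x) <= search_radius p.+1 f mu flow x.
    have e0 := enorm_ge0 (y - x).
    have e1 : enorm (y - x) = (enorm (y - x) ^+ p.+2) `^ (p.+2%:R^-1).
      by rewrite -powR_mulrn// -powRrM mulfV ?powRr1// pnatr_eq0.
    rewrite /search_radius [leLHS]e1.
    have Hrho : enorm (y - x) ^+ p.+2 <= p.+2`!%:R / mu * (fine (f x) - flow).
      rewrite mulrAC ler_pdivlMr// -ler_pdivrMl//.
      have := flowf y; move: Hyx; rewrite -(fineK fy) -(fineK fx) -EFinD !lee_fin.
      rewrite -Hmu /rho mulrC; lra.
    apply: ge0_ler_powR; rewrite ?nnegrE ?invr_ge0 ?ler0n ?exprn_ge0//.
    exact: le_trans (exprn_ge0 _ e0) Hrho.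
  have : (tensor_model p.+1 F g h M x1 x - tensor_model p.+1 F g h M y x
      <= (delta / p.+2`!%:R * enorm (x1 - x) ^+ p.+2)%R%:E)%E.
    apply: le_trans inexact; rewrite leeB//.
    by apply: ereal_inf_lbound; exists y.
  rewrite !sE// -EFinB lee_fin !fineE//.
  have -> : delta / p.+2`!%:R * enorm (x1 - x) ^+ p.+2 = delta * r.
    by rewrite /r [LHS]mulrAC -mulrA.
  have := Tr x1; have := Tr y; rewrite !ler_norml -/r -/rho.
  by move=> /andP[? _] /andP[_ ?]; lra.
- apply: le_trans (penalized_min_slope (ltW c0) fy Hy) _.
  rewrite lee_fin le_eqVlt; apply/orP; left; apply/eqP; congr (_ * _).
  rewrite factS natrM; field.
  by rewrite -natrD !pnatr_eq0 -!lt0n fact_gt0.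
Qed.

Theorem theorem4p10 (R : realType) (n m p : nat)
  (F : 'rV[R]_n -> 'rV[R]_m) (g : 'rV[R]_m -> R) (h : 'rV[R]_n -> \bar R)
  (Lp : 'rV[R]_m) (Lg flow M mu delta q fval : R) (x : nat -> 'rV[R]_n)
  (f := composite_objective F g h)
  (p_ge1 : (1 <= p)%N)
  (F_diff : forall i : 'I_m, times_differentiable p (component F i))
  (F_lip : forall i : 'I_m, Dform_lipschitz p (component F i) (Lp ord0 i))
  (g_convex : convex_function [set: 'rV[R]_m] g)
  (g_lip : elipschitz g Lg)
  (h_proper : proper_efun h)
  (h_lsc : lower_semicontinuous h)
  (h_convex : econvex h)
  (f_solution : exists xopt : 'rV[R]_n, forall y, (f xopt <= f y)%E)
  (f_lower : (flow%:E <= ereal_inf [set f y | y in edom f])%E)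
  (M_large : 0 < M - Lg * enorm Lp)
  (x_RHOTA : RHOTA p F g h M x)
  (mu_large : M + Lg * enorm Lp < mu)
  (delta_ge0 : 0 <= delta)
  (x_inexact : forall k : nat,
     (tensor_model p F g h M (x k.+1) (x k)
        - tensor_model_min p F g h M (search_radius p f mu flow (x k)) (x k)
      <= (delta / (p.+1)`!%:R * enorm (x k.+1 - x k) ^+ p.+1)%R%:E)%E)
  (x_bounded : bounded_fun x)
  (f_continuous : {within edom f, continuous f})
  (fval_limit : (f @` limit_points x) fval%:E)
  (f_KL : KL_property f (limit_points x) fval q) :
  ((p.+1)%:R / p%:R <= q -> linear_rate (fun k => fine (f (x k))) fval) /\
  (q < (p.+1)%:R / p%:R ->
     (fun k : nat => fine (f (x k)) - fval : R) =O_\oo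
     (fun k : nat => (k%:R `^ (p%:R * q / ((p.+1)%:R - p%:R * q)))^-1 : R)).
Proof.
(* From here the order of the model is [p.+1], so [p.+2] stands for the p + 1 of the statement. *)
case: p p_ge1 F_diff F_lip x_RHOTA x_inexact => [//|p] _ dF LF [M0 x0 xS] inexact.
have [hNy _] := h_proper.
have flowf y : (flow%:E <= f y)%E.
  have [fy|] := boolP (f y < +oo)%E; last first.
    by rewrite -leNgt leye_eq => /eqP ->; exact: leey.
  by apply: (le_trans f_lower); apply: ereal_inf_lbound; exists y.
have f_fin k : f (x k) \is a fin_num.
  rewrite fin_numElt (lt_le_trans (ltNyr flow) (flowf _))/=.
  by case: k => [//|k]; have [] := xS k.
set theta := Lg * enorm Lp in M_large mu_large.
have theta0 : 0 <= theta by exact: elipschitz_mul_enorm_ge0 g_lip.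
have mu0 : 0 < mu by lra.
pose b k := fine (f (x k)); pose a k := b k - fval.
have fact0 : (0 : R) < p.+2`!%:R by rewrite ltr0n fact_gt0.
pose kappa := M - theta.
pose r k := enorm (x k.+1 - x k) ^+ p.+2 / p.+2`!%:R.
have step k : b k.+1 + kappa * r k <= b k /\
  exists y, let rho := enorm (y - x k) ^+ p.+2 / p.+2`!%:R in
    [/\ f y \is a fin_num, (f y <= f (x k))%E,
        mu * rho + fine (f y) <= mu * r k + b k.+1,
        b k.+1 <= fine (f y) + (M + theta) * rho + (delta - kappa) * r k
      & (subdiff_slope f y <= (mu / p.+1`!%:R * enorm (y - x k) ^+ p.+1)%:E)%E].
  exact: (tensor_step_bounds dF LF g_lip hNy h_lsc flowf M0 mu_large
    delta_ge0 (f_fin k) (f_fin k.+1) (xS k).2 (inexact k)).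
have r0 k : 0 <= kappa * r k.
  by rewrite mulr_ge0 ?divr_ge0 ?(ltW M_large) ?(ltW fact0)// exprn_ge0// enorm_ge0.
have b_decr k : b k.+1 <= b k.
  have [h1 _] := step k; have := r0 k; lra.
have [z zx fz] := fval_limit; have [s s_incr xs] := zx.
(* Continuity of f relative to its domain identifies the limit along one subsequence; monotonicity
   extends it to all k and gives [fval <= b k]. *)
have bs : (b \o s) @ \oo --> fval.
  apply: (@fine_cvg _ _ _ _ (fun k => f (x (s k)))); rewrite -fz.
  have zdom : edom f z by rewrite /edom/= fz ltry.
  have /subspace_continuousP/(_ z zdom) fcont := f_continuous.
  move=> V /fcont/xs[N _ HN]; exists N => // k /HN; apply.
  by rewrite /edom/= ltey_eq f_fin.
have [b_ge b_cvg] := nonincreasing_subseq_cvg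
  ((nonincreasing_seqP b).1 b_decr) s_incr bs.
have a_cvg : a @ \oo --> 0.
  rewrite -(subrr fval); apply: cvgB => //; exact: cvg_cst.
have a_ge0 k : 0 <= a k by rewrite subr_ge0.
have a_decr k : 0 <= a k /\ a k.+1 <= a k by rewrite lerD2r.
have [q0 [sigma [dbar [ebar [sigma0 dbar0 ebar0 KL]]]]] := f_KL.
have [C xC] := bounded_fun_enorm x_bounded.
(* Adding [h2] and [h3] below gives (mu - (M + theta)) rho <= (mu + delta - kappa) r, and descent
   gives r <= d / kappa; hence rho <= c2 d. *)
pose c2 := (mu + delta) / (mu - (M + theta)) / kappa.
have c20 : 0 < c2 by rewrite !divr_gt0// /kappa; lra.
pose B := (M + theta) * c2 + delta / kappa.
have B0 : 0 < B.
  by apply: ltr_pwDl; [apply: mulr_gt0 => //; lra|exact: divr_ge0 (ltW M_large)].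
pose c3 := c2 * p.+2`!%:R; pose c4 := mu / p.+1`!%:R.
have c30 : 0 < c3 by rewrite mulr_gt0.
have c40 : 0 < c4 by rewrite divr_gt0// ltr0n fact_gt0.
pose t := p.+1%:R * q / p.+2%:R.
have t0 : 0 < t by rewrite divr_gt0// mulr_gt0.
pose A := sigma * (c4 `^ q * c3 `^ t).
have A0 : 0 < A by rewrite !mulr_gt0// powR_gt0.
have dbar2 : 0 < dbar / 2 by rewrite divr_gt0.
have a_rec : \forall k \near \oo,
    a k.+1 <= A * (a k - a k.+1) `^ t + B * (a k - a k.+1).
  have small e : 0 < e -> \forall k \near \oo, a k < e.
    move=> e0; move/cvgrPdist_lt : a_cvg => /(_ e e0); apply: filterS => k.
    by rewrite sub0r normrN ger0_norm.
  (* Below this threshold, d <= a k and |y - x_k|^(p+2) <= c3 d place y within dbar / 2 of x_k; the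
     other half is the distance from x_k to a limit point. *)
  have c3e0 : 0 < (dbar / 2) ^+ p.+2 / c3 by rewrite divr_gt0// exprn_gt0.
  apply: filterS3 (small _ ebar0) (small _ c3e0)
    (bounded_seq_near_limit_points xC dbar2) => k ake akd [w wx xw].
  have [h1 [y [fy fyx h2 h3 slope]]] := step k.
  set rho := enorm (y - _) ^+ _ / _ in h2 h3.
  have -> : a k - a k.+1 = b k - b k.+1 by rewrite /a opprB addrA subrK.
  set d := b k - b k.+1.
  have d0 : 0 <= d by rewrite subr_ge0.
  have rd : r k <= d / kappa by rewrite ler_pdivlMr// /d mulrC; lra.
  have rho_d : rho <= c2 * d.
    have -> : c2 * d = (mu + delta) * (d / kappa) / (mu - (M + theta)).
      by rewrite /c2; field; rewrite (gt_eqF M_large) gt_eqF ?subr_gt0.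
    rewrite ler_pdivlMr; last by lra.
    have mud0 : 0 <= mu + delta by lra.
    have := ler_wpM2l mud0 rd; have := r0 k; lra.
  have e_d : enorm (y - x k) ^+ p.+2 <= c3 * d.
    by rewrite /c3 mulrAC -ler_pdivrMr.
  have e0 := enorm_ge0 (y - x k).
  have h4 : b k.+1 <= fine (f y) + B * d.
    apply: (le_trans h3); rewrite -addrA lerD2l /B mulrDl.
    have rd1 := ler_wpM2l delta_ge0 rd; have rd2 := r0 k.
    have Mt : 0 <= M + theta by lra.
    have := ler_wpM2l Mt rho_d; lra.
  suff : fine (f y) - fval <= A * d `^ t by rewrite /a; lra.
  (* KL speaks only of values above [fval]; at or below it the left side is nonpositive. *)
  have [fyv|fyv] := leP (fine (f y)) fval.
    by apply: (@le_trans _ _ 0); [lra|rewrite mulr_ge0 ?powR_ge0// ltW].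
  have y_near : (euclid_dist y (limit_points x) <= dbar%:E)%E.
    apply: (@le_trans _ _ (enorm (y - w))%:E).
      by apply: ereal_inf_lbound; exists w.
    rewrite lee_fin -(subrKA (x k)) (le_trans (enormD _ _))//.
    suff : enorm (y - x k) <= dbar / 2 by lra.
    rewrite -(@ler_pXn2r _ p.+2)// ?nnegrE ?(ltW dbar2)//.
    apply: (le_trans e_d); move: akd; rewrite ltr_pdivlMr// mulrC => /ltW.
    apply: le_trans.
    by rewrite ler_wpM2l ?(ltW c30)// /d /a lerD2l lerN2.
  have := KL y y_near; rewrite -(fineK fy) !lte_fin => /(_ fyv).
  have fyb : fine (f y) <= b k by rewrite -lee_fin /b !fineK.
  move=> /(_ _)/le_trans KL'; rewrite -lee_fin EFinB.
  apply: KL'; first by move: ake; rewrite /a; lra.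
  have ep0 : 0 <= enorm (y - x k) ^+ p.+1 by rewrite exprn_ge0.
  apply: (@le_trans _ _ (sigma%:E * ((c4 * enorm (y - x k) ^+ p.+1) `^ q)%:E)%E).
    rewrite lee_pmul2l// -poweR_EFin; apply: gt0_ler_poweR slope; first exact: ltW.
    - by rewrite in_itv/= subdiff_slope_ge0 leey.
    - by rewrite in_itv/= leey andbT lee_fin mulr_ge0// ltW.
  rewrite -EFinM lee_fin /A -(mulrA sigma) -(mulrA (c4 `^ q)).
  apply: ler_wpM2l; first exact: ltW.
  rewrite powRM ?(ltW c40)// ler_wpM2l ?powR_ge0// -powRM ?(ltW c30)//.
  (* The exponent t is chosen for this identity: it converts the power in the slope bound into the
     one controlled by d. *)
  have -> : (enorm (y - x k) ^+ p.+1) `^ q = (enorm (y - x k) ^+ p.+2) `^ t.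
    rewrite -!powR_mulrn// -!powRrM /t; congr (_ `^ _).
    by rewrite [RHS]mulrC divfK// pnatr_eq0.
  have c3d : 0 <= c3 * d by exact: mulr_ge0 (ltW c30) d0.
  by apply: ge0_ler_powR => //; rewrite ?nnegrE ?exprn_ge0 ?(ltW t0).
have [lin sub] := rate_of_recursion A0 B0 t0 a_cvg a_decr a_rec.
have p10 : (0 : R) < p.+1%:R by [].
have p20 : (0 : R) < p.+2%:R by [].
split=> qp.
- have [|c [c0 c1 ac]] := lin.
    by rewrite ler_pdivlMr// mul1r mulrC -ler_pdivrMr.
  exists c; split=> //; apply: filterS ac => k.
  by rewrite -/(b k) -/(b k.+1) -/(a k) -/(a k.+1) !ger0_norm.
- have pq : p.+1%:R * q < p.+2%:R by rewrite mulrC -ltr_pdivlMr.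
  have [|D aD] := sub.
    by rewrite ltr_pdivrMr// mul1r.
  have tE : t / (1 - t) = p.+1%:R * q / (p.+2%:R - p.+1%:R * q).
    by rewrite /t; field; rewrite -natrD nat1r add2n pnatr_eq0 andbT gt_eqF// subr_gt0.
  (* The constant D comes without a sign, whereas the O-notation requires a positive one. *)
  apply/eqO_exP; exists (Num.max D 1); first by rewrite lt_max ltr01 orbT.
  apply: filterS aD => k; rewrite tE -/(b k) -/(a k) => aD.
  rewrite ger0_norm// (le_trans aD)// ger0_norm ?invr_ge0 ?powR_ge0//.
  by rewrite ler_wpM2r ?invr_ge0 ?powR_ge0// le_max lexx.
Qed.
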